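(* Let $q$ be a power of an odd prime. Let $\mathcal{K}\subset\mathbb{F}_q$ be either a radius circular Kakeya set in $\mathbb{F}_q$ of minimal size (among all radius circular Kakeya sets in $\mathbb{F}_q$), or a center circular Kakeya set in $\mathbb{F}_q$ of minimal size (among all center circular Kakeya sets in $\mathbb{F}_q$). Then $$q^{1/2}\le |\mathcal{K}|<6q^{1/2}.$$
   Context: $\mathbb{F}_q$ is the finite field with $q$ elements and $\mathbb{F}_q^*=\mathbb{F}_q\setminus\{0\}$. The circle in $\mathbb{F}_q$ with radius $r\in\mathbb{F}_q^*$ and center $a\in\mathbb{F}_q$ is $\{x\in\mathbb{F}_q : (x-a)^2=r^2\}=\{a+r,a-r\}$. A radius circular Kakeya set in $\mathbb{F}_q$ is a subset of $\mathbb{F}_q$ such that for each $r\in\mathbb{F}_q^*$ it contains a circle of radius $r$ (with some center $a\in\mathbb{F}_q$). A center circular Kakeya set in $\mathbb{F}_q$ is a subset of $\mathbb{F}_q$ such that for each $a\in\mathbb{F}_q$ it contains a circle with center $a$ (of some radius $r\in\mathbb{F}_q^*$). *)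

(* Defs.v *)
From mathcomp Require Import all_boot all_order all_algebra.

Set Implicit Arguments.
Unset Strict Implicit.
Unset Printing Implicit Defensive.

Import GRing.Theory.
Local Open Scope ring_scope.

Definition circle (F : finFieldType) (a r : F) : {set F} :=
  [set x | (x - a) ^+ 2 == r ^+ 2].

Definition radius_circular_Kakeya (F : finFieldType) (K : {set F}) : Prop :=
  forall r : F, r != 0 -> exists a : F, circle a r \subset K.

Definition center_circular_Kakeya (F : finFieldType) (K : {set F}) : Prop :=
  forall a : F, exists2 r : F, r != 0 & circle a r \subset K.

(* Minimality of the cardinality, not of the set for inclusion (as [minset]). *)
Definition of_minimal_size (T : finType) (P : {set T} -> Prop) (K : {set T}) :
    Prop :=
  P K /\ forall K' : {set T}, P K' -> (#|K| <= #|K'|)%N.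

(* Main.v *)
Require Import Defs.
From mathcomp Require Import all_boot all_order all_algebra reals.
From mathcomp Require Import all_fingroup all_solvable finfield.
From mathcomp Require Import zify ring.

(** The circle of centre [a] and radius [r] is the pair [{a + r, a - r}], so a
    radius Kakeya set is a [K] with [K - K = F], and a centre Kakeya set is a
    [K] such that every element of [F] is a sum of two distinct elements of
    [K]. In both cases [F] is an image of [K x K], whence [q <= #|K|^2].

    For the upper bound write [F = A + B] with [#|A|, #|B| <= n] and
    [4 n^2 < 9 q]. Then [A :|: - B] is a radius Kakeya set, and
    [A :|: B :|: (A + 1) :|: (B - 1)] is a centre Kakeya set: if [x = a + b]
    with [a = b], use [x = (a + 1) + (b - 1)] instead. To get [A] and [B] when
    [q] is a square, take a subgroup of order [sqrt q] and a transversal. When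
    [q = p^(2m+1)], insert between a subgroup [H] of order [p^m] and a
    transversal of an overgroup of order [p^(m+1)] the representatives
    [(i + s j) g] of the cyclic group of order [p], where [i, j < s] and
    [p <= s^2], and give the terms [i g] to [H] and [s j g] to the
    transversal. *)

Import GRing.Theory Num.Theory.

Local Open Scope ring_scope.

(** * Covering a finite group by a product of two small sets *)

Lemma leq_card_mulg (gT : finGroupType) (A B : {set gT}) :
  (#|(A * B)%g| <= #|A| * #|B|)%N.
Proof.
rewrite -cardsX -[(A * B)%g]/([set (x * y)%g | x in A, y in B]).
by rewrite curry_imset2X; exact: leq_imset_card.
Qed.

Lemma rcosets_transversal (gT : finGroupType) (G H : {group gT}) :
  exists T : {set gT}, (#|T| <= #|G : H|%g)%N /\ G \subset (H * T)%g.
Proof.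
exists [set repr C | C in rcosets H G]; split; first exact: leq_imset_card.
apply/subsetP => x Gx; rewrite -[x](mulgKV (repr (H :* x)%g)).
apply: mem_mulg; last by apply: imset_f; apply/rcosetsP; exists x.
by rewrite -groupV invMg invgK -mem_rcoset mem_repr_rcoset.
Qed.

Lemma sqrt_approx (p : nat) :
  (0 < p)%N -> exists s : nat, (p <= s ^ 2)%N /\ (4 * s ^ 2 < 9 * p)%N.
Proof.
move=> p_gt0.
have ex_s : exists s, (p <= s ^ 2)%N by exists p; nia.
case: (ex_minnP ex_s) => s ps min_s; exists s; split=> //.
case: s ps min_s => [|s] ps min_s; first by nia.
(* Now [s] is the predecessor of the least root, so [p >= s^2 + 1], and [9 (s^2 + 1) - 4 (s + 1)^2 =
   5 s^2 - 8 s + 5] has negative discriminant, hence is positive. *)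
have : ~~ (p <= s ^ 2)%N by apply/negP => /min_s; rewrite ltnn.
by nia.
Qed.

(** Exponents of a generator of the quotient are below [s ^ 2], so they have two digits in base [s]:
    the low digit goes to [A], the high one to [B]. *)
Lemma cyclic_quotient_cover (gT : finGroupType) (G H : {group gT}) (s : nat) :
    (H <| G)%g -> cyclic (G / H)%g -> (#|G : H|%g <= s ^ 2)%N ->
  exists A B : {set gT},
    [/\ (#|A| <= s)%N, (#|B| <= s)%N & G \subset (H * A * B)%g].
Proof.
move=> nsHG /cyclicP [xbar defQ] le_s2.
have nHG := normal_norm nsHG.
have ord_x : #[xbar]%g = #|G : H|%g by rewrite orderE -defQ card_quotient.
case: (cosetP xbar) => g Ng def_x.
exists [set (g ^+ val i)%g | i : 'I_s], [set (g ^+ (s * val j))%g | j : 'I_s].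
split; try by rewrite (leq_trans (leq_imset_card _ _)) ?card_ord.
apply/subsetP => x Gx; have Nx := subsetP nHG x Gx.
have : coset H x \in <[xbar]>%g by rewrite -defQ mem_quotient.
case/cyclePmin => i; rewrite ord_x => /leq_trans/(_ le_s2) lt_i.
rewrite def_x -morphX // => eq_x.
have [z Hz ->] := kercoset_rcoset Nx (groupX i Ng) eq_x.
have s_gt0 : (0 < s)%N by case: (s) lt_i.
have lt_ms : (i %% s < s)%N by rewrite ltn_mod.
have lt_ds : (i %/ s < s)%N by rewrite ltn_divLR // mulnn.
rewrite {1}(divn_eq i s) addnC mulnC expgD mulgA !mem_mulg //.
  by apply/imsetP; exists (Ordinal lt_ms).
by apply/imsetP; exists (Ordinal lt_ds).
Qed.

(** Along a chain [H <= H1 <= G] the group is [H * A * B * T]; the groupings [H * A] and [B * T]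
    both have at most [p ^ m * s] elements. *)
Lemma pgroup_balanced_factors (gT : finGroupType) (G : {group gT}) (p k : nat) :
    prime p -> #|G| = (p ^ k)%N ->
  exists (A B : {set gT}) (n : nat),
    [/\ (#|A| <= n)%N, (#|B| <= n)%N, (4 * n ^ 2 < 9 * #|G|)%N
      & G \subset (A * B)%g].
Proof.
move=> pr_p oG; set m := k./2.
have p_gt0 := prime_gt0 pr_p.
(* This treats both parities at once: for even [k] the quotient [H1 / H] is trivial and [s] is 1. *)
have def_k : k = (odd k + m + m)%N by rewrite -addnA addnn odd_double_half.
have pG : p.-group%g G by rewrite /pgroup oG pnatX pnat_id.
have [H1 [sH1G _ oH1]] : exists H1 : {group gT},
    [/\ H1 \subset G, (H1 <| G)%g & #|H1| = (p ^ (odd k + m))%N].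
  by apply: normal_pgroup; rewrite ?normal_refl // oG pfactorK //; lia.
have [H [sHH1 nsHH1 oH]] : exists H : {group gT},
    [/\ H \subset H1, (H <| H1)%g & #|H| = (p ^ m)%N].
  apply: normal_pgroup; rewrite ?normal_refl ?(pgroupS sH1G) //.
  by rewrite oH1 pfactorK ?leq_addl.
have iH : #|H1 : H|%g = (p ^ odd k)%N.
  by rewrite -divgS // oH1 oH expnD mulnK ?expn_gt0 ?p_gt0.
have iH1 : #|G : H1|%g = (p ^ m)%N.
  by rewrite -divgS // oG oH1 {1}def_k expnD mulKn ?expn_gt0 ?p_gt0.
have cycH : cyclic (H1 / H)%g.
  have oQ : #|(H1 / H)%g| = (p ^ odd k)%N.
    by rewrite card_quotient ?normal_norm.
  case: (odd k) oQ => oQ; first by rewrite prime_cyclic // oQ.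
  by rewrite (card1_trivg oQ) cyclic1.
have [s [le_s lt_s]] : exists s, (p ^ odd k <= s ^ 2)%N /\
    (4 * s ^ 2 < 9 * p ^ odd k)%N by apply: sqrt_approx; rewrite expn_gt0 p_gt0.
have [A [B [leA leB coverH1]]] : exists A B : {set gT},
    [/\ (#|A| <= s)%N, (#|B| <= s)%N & H1 \subset (H * A * B)%g].
  by apply: cyclic_quotient_cover; rewrite ?iH.
have [T [leT coverG]] := rcosets_transversal gT G H1.
exists (H * A)%g, (B * T)%g, (p ^ m * s)%N; split.
- by rewrite (leq_trans (leq_card_mulg _ _ _)) // oH leq_mul.
- by rewrite (leq_trans (leq_card_mulg _ _ _)) // mulnC leq_mul // -iH1.
- have -> : (4 * (p ^ m * s) ^ 2 = 4 * s ^ 2 * (p ^ m * p ^ m))%N.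
    by rewrite expnMn; ring.
  rewrite oG def_k -addnA !expnD [(9 * _)%N]mulnA ltn_mul2r lt_s andbT.
  by rewrite muln_gt0 expn_gt0 p_gt0.
- by rewrite mulgA; apply: subset_trans coverG _; apply: mulSg.
Qed.

Lemma finField_balanced_summands (F : finFieldType) (p k : nat) :
    prime p -> #|F| = (p ^ k)%N ->
  exists (A B : {set F}) (n : nat),
    [/\ (#|A| <= n)%N, (#|B| <= n)%N, (4 * n ^ 2 < 9 * #|F|)%N
      & forall x, exists a b, [/\ a \in A, b \in B & x = a + b]].
Proof.
move=> pr_p oF.
have oG : #|[set: F]%G| = (p ^ k)%N by rewrite cardsT.
have [A [B [n [leA leB lt_n cover]]]] :=
  pgroup_balanced_factors F _ p k pr_p oG.
exists A, B, n; split=> //; first by rewrite -cardsT.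
move=> x; have /mulsgP [a b Aa Bb ->] := subsetP cover x (in_setT x).
by exists a, b.
Qed.

(** * Kakeya sets as sets of differences or sums *)

Section CircularKakeya.

Variable F : finFieldType.
Hypothesis two_neq0 : 2 != 0 :> F.
Implicit Types (K : {set F}) (a r x y : F).

Lemma circleE a r : circle a r = [set a + r; a - r].
Proof.
apply/setP => x; rewrite !inE eqf_sqr.
by rewrite !subr_eq [r + a]addrC [- r + a]addrC.
Qed.

(** The two points of a circle differ by [2 r], and 2 is invertible. *)
Lemma radius_circular_KakeyaP K :
  radius_circular_Kakeya K <->
  forall d, d != 0 -> exists x y, [/\ x \in K, y \in K & d = x - y].
Proof.
split=> [radK d d_neq0 | diffK r r_neq0].
  have [|a] := radK (d / 2); first by rewrite mulf_neq0 ?invr_eq0.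
  rewrite circleE subUset !sub1set => /andP [Kx Ky].
  by exists (a + d / 2), (a - d / 2); split=> //; field.
have [|x [y [Kx Ky def_r]]] := diffK (2 * r); first by rewrite mulf_neq0.
have {}def_r : r = (x - y) / 2 by rewrite -def_r mulrC mulKf.
exists ((x + y) / 2); rewrite circleE subUset !sub1set def_r.
have -> : (x + y) / 2 + (x - y) / 2 = x by field.
have -> : (x + y) / 2 - (x - y) / 2 = y by field.
by rewrite Kx.
Qed.

(** The two points of a circle sum to [2 a], and are distinct exactly when [r] is nonzero. *)
Lemma center_circular_KakeyaP K :
  center_circular_Kakeya K <->
  forall c, exists x y, [/\ x \in K, y \in K, x != y & c = x + y].
Proof.
split=> [cenK c | sumK a].
  have [r r_neq0] := cenK (c / 2).
  rewrite circleE subUset !sub1set => /andP [Kx Ky].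
  exists (c / 2 + r), (c / 2 - r); split=> //; last by field.
  rewrite -subr_eq0; have -> : c / 2 + r - (c / 2 - r) = 2 * r by field.
  by rewrite mulf_neq0.
have [x [y [Kx Ky neq_xy def_a]]] := sumK (2 * a).
have {}def_a : a = (x + y) / 2 by rewrite -def_a mulrC mulKf.
exists ((x - y) / 2); first by rewrite mulf_neq0 ?invr_eq0 ?subr_eq0.
rewrite circleE subUset !sub1set def_a.
have -> : (x + y) / 2 + (x - y) / 2 = x by field.
have -> : (x + y) / 2 - (x - y) / 2 = y by field.
by rewrite Kx.
Qed.

Lemma card_le_sqr K (f : F -> F -> F) :
  (forall z, exists x y, [/\ x \in K, y \in K & z = f x y]) ->
  (#|F| <= #|K| ^ 2)%N.
Proof.
move=> surj; rewrite -mulnn -cardsX -cardsT.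
apply: leq_trans (leq_imset_card (fun u => f u.1 u.2) _).
apply/subset_leq_card/subsetP => z _; have [x [y [Kx Ky ->]]] := surj z.
by apply/imsetP; exists (x, y); rewrite ?inE ?Kx.
Qed.

Lemma radius_circular_Kakeya_ge K :
  radius_circular_Kakeya K -> (#|F| <= #|K| ^ 2)%N.
Proof.
move=> /radius_circular_KakeyaP diffK.
apply: (card_le_sqr K (fun x y => x - y)) => z.
(* The difference 0 is [x - x]; the difference 1 supplies a point [x] of [K]. *)
have [-> | ] := eqVneq z 0; last exact: diffK.
have [x [_ [Kx _ _]]] := diffK 1 (oner_neq0 F).
by exists x, x; rewrite subrr.
Qed.

Lemma center_circular_Kakeya_ge K :
  center_circular_Kakeya K -> (#|F| <= #|K| ^ 2)%N.
Proof.
move=> /center_circular_KakeyaP sumK.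
apply: (card_le_sqr K +%R) => z.
by have [x [y [Kx Ky _ ->]]] := sumK z; exists x, y.
Qed.

Lemma radius_circular_Kakeya_of_summands (A B : {set F}) :
    (forall x, exists a b, [/\ a \in A, b \in B & x = a + b]) ->
  exists2 K : {set F}, radius_circular_Kakeya K & (#|K| <= #|A| + #|B|)%N.
Proof.
move=> cover; exists (A :|: [set - b | b in B]).
  apply/radius_circular_KakeyaP => d _; have [a [b [Aa Bb ->]]] := cover d.
  by exists a, (- b); rewrite !inE Aa imset_f ?orbT ?opprK.
by apply: leq_trans (leq_card_setU _ _) _; rewrite leq_add2l leq_imset_card.
Qed.

Lemma center_circular_Kakeya_of_summands (A B : {set F}) :
    (forall x, exists a b, [/\ a \in A, b \in B & x = a + b]) ->
  exists2 K : {set F}, center_circular_Kakeya K & (#|K| <= 2 * (#|A| + #|B|))%N.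
Proof.
move=> cover.
exists ((A :|: B) :|: ([set a + 1 | a in A] :|: [set b - 1 | b in B])).
  apply/center_circular_KakeyaP => c; have [a [b [Aa Bb ->]]] := cover c.
  have [eq_ab | neq_ab] := eqVneq a b; last first.
    by exists a, b; rewrite !inE Aa Bb ?orbT.
  exists (a + 1), (b - 1); rewrite !inE.
  rewrite (imset_f (+%R^~ 1) Aa) (imset_f (+%R^~ (- 1)) Bb) !orbT.
  split=> //; last by ring.
  (* The shifted summands differ by 2, which is nonzero. *)
  by rewrite eq_ab -subr_eq0 (_ : _ - _ = 2) //; ring.
rewrite mul2n -addnn.
apply: leq_trans (leq_card_setU _ _) _; apply: leq_add.
  exact: leq_card_setU.
by apply: leq_trans (leq_card_setU _ _) _; rewrite leq_add ?leq_imset_card.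
Qed.

End CircularKakeya.

Theorem theorem5p1 (R : realType) (p k : nat) (F : finFieldType) (K : {set F})
    (p_prime : prime p) (p_odd : odd p) (k_gt0 : (0 < k)%N)
    (cardF : #|F| = (p ^ k)%N)
    (K_min : of_minimal_size (@radius_circular_Kakeya F) K \/
             of_minimal_size (@center_circular_Kakeya F) K) :
  Num.sqrt (#|F|%:R : R) <= #|K|%:R /\
  #|K|%:R < 6 * Num.sqrt (#|F|%:R : R).
Proof.
have two_neq0 : 2 != 0 :> F.
  have charF : p \in [pchar F] := card_finPcharP cardF p_prime.
  rewrite -(dvdn_pcharf charF); apply: contraL p_odd.
  by rewrite dvdn_prime2 // => /eqP ->.
(* Squaring turns both real bounds into inequalities between natural numbers. *)
suff [ge_K lt_K] : (#|F| <= #|K| ^ 2)%N /\ (#|K| ^ 2 < 36 * #|F|)%N.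
  have sqrt_sqr (n : nat) : Num.sqrt ((n ^ 2)%:R : R) = n%:R.
    by rewrite natrX sqrtr_sqr ger0_norm.
  rewrite -(sqrt_sqr #|K|) -(sqrt_sqr 6) -sqrtrM //.
  by rewrite -natrM ler_sqrt ?ltr_sqrt ?ler_nat ?ltr_nat ?ltr0n //; lia.
have [A [B [n [leA leB lt_n cover]]]] :=
  finField_balanced_summands F p k p_prime cardF.
have [K_ge [K' [K'_kakeya leK']]] : (#|F| <= #|K| ^ 2)%N /\
    exists K' : {set F}, (#|K| <= #|K'|)%N /\ (#|K'| <= 2 * (#|A| + #|B|))%N.
  case: K_min => -[K_kakeya K_min]; split.
  - exact: radius_circular_Kakeya_ge.
  - have [K' /K_min] := radius_circular_Kakeya_of_summands F two_neq0 A B cover.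
    by exists K'; split=> //; lia.
  - exact: center_circular_Kakeya_ge.
  - have [K' /K_min] := center_circular_Kakeya_of_summands F two_neq0 A B cover.
    by exists K'.
(* Here [#|K| <= 4 n], so [#|K| ^ 2 <= 16 n^2 < 36 #|F|]; this is where the factor 9/4 is used. *)
by split=> //; nia.
Qed.
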